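(* Let $n\ge 3$ and let $X=\mathrm{Circ}_n$ be the cycle graph on vertices $1,\dots,n$. The bi-threshold sequential dynamical system map $\mathbf{F}_\pi$ over $X$ with update sequence $\pi=(1,2,3,\dots,n)$ and thresholds $k^\uparrow=1$ and $k^\downarrow=3$ at every vertex has a cycle (periodic orbit) of length $n-1$.
   Context: $\mathrm{Circ}_n$ has vertex set $\{1,\dots,n\}$ and edges $\{i,i+1\}$ for $1\le i\le n-1$ together with $\{n,1\}$. Let $K=\{0,1\}$. For a vertex $v$, $N[v]$ denotes the closed neighborhood of $v$ ($v$ together with its neighbors). For $x\in K^n$ put $\sigma(x[v])=|\{u\in N[v] : x_u=1\}|$ (this count includes $v$ itself). The bi-threshold vertex function $f_v$ with up-threshold $k^\uparrow$ and down-threshold $k^\downarrow$ is: if $x_v=0$, then $f_v=1$ when $\sigma(x[v])\ge k^\uparrow$ and $f_v=0$ otherwise; if $x_v=1$, then $f_v=1$ when $\sigma(x[v])\ge k^\downarrow$ and $f_v=0$ otherwise. The map $F_v\colon K^n\to K^n$ replaces the coordinate $x_v$ by $f_v$ evaluated at $x$ and leaves all other coordinates unchanged. For a permutation $\pi=(\pi_1,\dots,\pi_n)$ of the vertices, $\mathbf{F}_\pi=F_{\pi_n}\circ\cdots\circ F_{\pi_1}$. A cycle of length $p$ is the orbit of a state $x$ with $\mathbf{F}_\pi^p(x)=x$ and $p\ge 1$ minimal with this property. *)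

(* Defs.v *)
From mathcomp Require Import all_boot.

Set Implicit Arguments.
Unset Strict Implicit.
Unset Printing Implicit Defensive.

(* A graph on the finite vertex type V is given by its adjacency relation
   e : rel V; the state space K^V is {ffun V -> bool}, with true for 1 and
   false for 0. *)

Definition closed_nbhd (V : finType) (e : rel V) (v : V) : {set V} :=
  [set u | (u == v) || e v u].

Definition sigma (V : finType) (e : rel V) (x : {ffun V -> bool}) (v : V) : nat :=
  #|[set u in closed_nbhd e v | x u]|.

Definition bithreshold (V : finType) (e : rel V) (kup kdown : nat)
    (v : V) (x : {ffun V -> bool}) : bool :=
  if x v then kdown <= sigma e x v else kup <= sigma e x v.

Definition local_map (V : finType) (e : rel V) (kup kdown : nat)
    (v : V) (x : {ffun V -> bool}) : {ffun V -> bool} :=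
  [ffun u => if u == v then bithreshold e kup kdown v x else x u].

(* The head of the update sequence pi is applied first:
   F_(pi_n) \o ... \o F_(pi_1). *)
Definition sds_map (V : finType) (e : rel V) (kup kdown : nat)
    (pi : seq V) (x : {ffun V -> bool}) : {ffun V -> bool} :=
  foldl (fun y v => local_map e kup kdown v y) x pi.

(* The vertex i : 'I_n, with value 0 <= i < n, stands for the vertex i + 1
   of {1, ..., n}: the edges are {i, i+1} and the closing edge {n, 1}. *)
Definition circ (n : nat) : rel 'I_n :=
  fun i j => [|| i.+1 == j, j.+1 == i,
                 (i.+1 == n) && (j == 0 :> nat) |
                 (j.+1 == n) && (i == 0 :> nat)].

Definition minimal_period (T : Type) (F : T -> T) (p : nat) (x : T) : Prop :=
  [/\ 0 < p, iter p F x = x & forall q, 0 < q < p -> iter q F x <> x].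

Definition has_cycle_of_length (T : Type) (F : T -> T) (p : nat) : Prop :=
  exists x : T, minimal_period F p x.

(* Main.v *)
Require Import Defs.
From mathcomp Require Import all_boot zify.

(* A lone 1 at a vertex other than the first and the last moves one step to the
   left under F_pi.  From the second vertex it moves to the first one, which
   makes the last vertex, updated at the end of the same sweep, switch on as
   well; the next sweep sends this pair to the lone 1 at the last vertex but
   one.  So these n - 1 states form a cycle. *)

Set Implicit Arguments.
Unset Strict Implicit.
Unset Printing Implicit Defensive.

Lemma val_ordS n (i : 'I_n) : ordS i = (if i.+1 == n then 0 else i.+1) :> nat.
Proof.
rewrite /=; case: eqP => [->|ne]; first by rewrite modnn.
by rewrite modn_small //; have := ltn_ord i; lia.
Qed.

Lemma val_ord_pred n (i : 'I_n) :
  ord_pred i = (if i == 0 :> nat then n.-1 else i.-1) :> nat.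
Proof.
have lt_in := ltn_ord i; rewrite /=; case: eqP => [->|ne].
  by rewrite add0n modn_small //; lia.
have -> : (i + n).-1 = i.-1 + n by lia.
by rewrite modnDr modn_small //; lia.
Qed.

Lemma closed_nbhd_circ n (v : 'I_n) :
  closed_nbhd (@circ n) v = [set ord_pred v; v; ordS v].
Proof.
apply/setP => u; rewrite !inE /circ -!(inj_eq (@ord_inj _)) val_ordS val_ord_pred.
have := ltn_ord u; have := ltn_ord v; case: (v =P 0 :> nat) => v0;
  case: (v.+1 =P n) => vn; lia.
Qed.

(** For [2 < n] a vertex and its two cyclic neighbors are pairwise distinct, so the cardinality
    splits into three summands. *)
Lemma sigma_circ n (x : {ffun 'I_n -> bool}) (v : 'I_n) : 2 < n ->
  sigma (@circ n) x v = x (ord_pred v) + x v + x (ordS v).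
Proof.
move=> n_gt2; rewrite /sigma closed_nbhd_circ -sum1_card.
rewrite (eq_bigl (fun u => (u \in [set ord_pred v; v; ordS v]) && x u)); last first.
  by move=> u; rewrite !inE.
rewrite big_mkcondr -setUA big_setU1 ?big_setU1 ?big_set1 /=.
- by rewrite -addnA; do 3 case: (x _).
- by rewrite inE -!(inj_eq (@ord_inj _)) val_ordS; have := ltn_ord v;
  case: (v.+1 =P n) => vn; lia.
rewrite !inE -!(inj_eq (@ord_inj _)) val_ordS val_ord_pred; have := ltn_ord v.
by case: (v =P 0 :> nat) => v0; case: (v.+1 =P n) => vn; lia.
Qed.

Lemma bithreshold_circ13 n (x : {ffun 'I_n -> bool}) (v : 'I_n) : 2 < n ->
  bithreshold (@circ n) 1 3 v x =
    (if x v then x (ord_pred v) && x (ordS v) else x (ord_pred v) || x (ordS v)).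
Proof.
by move=> n_gt2; rewrite /bithreshold sigma_circ //; do 3 case: (x _).
Qed.

(** The state in the middle of a sweep from [x] to [y], when exactly the vertices below [k] have
    been updated. *)
Definition splice n (k : nat) (y x : {ffun 'I_n -> bool}) : {ffun 'I_n -> bool} :=
  [ffun u : 'I_n => if u < k then y u else x u].

(** Reduces a sweep with guessed result [y] to one check per vertex, by induction on the number of
    vertices already updated. *)
Lemma sds_map_enum n (e : rel 'I_n) kup kdown (x y : {ffun 'I_n -> bool}) :
    (forall v : 'I_n, bithreshold e kup kdown v (splice v y x) = y v) ->
  sds_map e kup kdown (enum 'I_n) x = y.
Proof.
move=> yP; suff spliceP k : k <= n ->
    sds_map e kup kdown (take k (enum 'I_n)) x = splice k y x.
  have := spliceP n (leqnn n); rewrite take_oversize ?size_enum_ord // => ->.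
  by apply/ffunP => u; rewrite ffunE ltn_ord.
elim: k => [_|k IHk lt_kn]; first by rewrite take0; apply/ffunP => u; rewrite ffunE.
pose v := Ordinal lt_kn.
rewrite (take_nth v) ?size_enum_ord // (_ : nth v _ k = v); last first.
  by apply: val_inj; rewrite /= nth_enum_ord.
move: (IHk (ltnW lt_kn)); rewrite /sds_map -cats1 foldl_cat => -> /=.
apply/ffunP => u; rewrite !ffunE (yP v) ltnS [u <= k]leq_eqVlt
  -(inj_eq (@ord_inj _)) /=.
by case: eqP => [eq_uk|//]; congr (y _); apply: val_inj.
Qed.

Definition pulse n (j : nat) : {ffun 'I_n -> bool} :=
  [ffun i : 'I_n => (i == j :> nat) || (j == 0) && (i == n.-1 :> nat)].

Lemma sds_map_pulse n j : 2 < n -> j < n.-1 ->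
  sds_map (@circ n) 1 3 (enum 'I_n) (pulse n j) =
    pulse n (if j == 0 then n.-2 else j.-1).
Proof.
move=> n_gt2 lt_jn; apply: sds_map_enum => v.
(* A vertex sees a new left and an old right neighbor, except across the closing edge: the first
   vertex sees the old last value, the last vertex the new first value. *)
rewrite bithreshold_circ13 // !ffunE ltnn val_ordS val_ord_pred.
have := ltn_ord v; case: (j =P 0) => j0; case: (v =P 0 :> nat) => v0;
  case: (v.+1 =P n) => vn; do ![case: ifP => ?]; lia.
Qed.

Theorem proposition3p6 (n : nat) (hn : 3 <= n) :
  has_cycle_of_length (sds_map (@circ n) 1 3 (enum 'I_n)) n.-1.
Proof.
set F := sds_map _ _ _ _.
have iterF k : k <= n.-2 -> iter k F (pulse n n.-2) = pulse n (n.-2 - k).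
  elim: k => [|k IHk] le_k; first by rewrite subn0.
  rewrite iterS IHk; last by lia.
  rewrite /F sds_map_pulse; [|lia..].
  by case: eqP => ?; congr (pulse n _); lia.
exists (pulse n n.-2); split; first by lia.
  (* After [n.-2] sweeps the state is [pulse n 0]; one more returns to the start. *)
  have -> : n.-1 = n.-2.+1 by lia.
  by rewrite iterS iterF // subnn /F sds_map_pulse //; lia.
move=> q q_bounds; rewrite iterF; last by lia.
have lt_n : n.-2 < n by lia.
(* Vertex [n.-2] is 1 at the start but 0 after [q] sweeps, since [n.-2 - q < n.-2 < n.-1]. *)
by move/ffunP/(_ (Ordinal lt_n)); rewrite !ffunE /=; lia.
Qed.
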